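(* (Equivalence of LP-Struct and LP-Unif.) Let $\Phi$ be a non-overlapping and productive logic program. Then: (1) if $\Phi\vdash\{A_1,\dots,A_n\}\leadsto\{B_1,\dots,B_m\}$, then there is a multiset $\{C_1,\dots,C_l\}$ with $\Phi\vdash\{A_1,\dots,A_n\}(\to^\mu\cdot\hookrightarrow^1)^*\{C_1,\dots,C_l\}$ and $\Phi\vdash\{B_1,\dots,B_m\}\to^*\{C_1,\dots,C_l\}$; (2) if $\Phi\vdash\{A_1,\dots,A_n\}(\to^\mu\cdot\hookrightarrow^1)^*\{B_1,\dots,B_m\}$, then $\Phi\vdash\{A_1,\dots,A_n\}\leadsto^*\{B_1,\dots,B_m\}$.
   Context: Atomic formulas $P(t_1,\dots,t_n)$ over first-order terms; a logic program is a list of closed Horn formulas $\kappa:\forall\underline{x}.B_1,\dots,B_m\Rightarrow C$ ($m\ge0$) labelled by distinct constants $\kappa$; quantified variables are renamed apart at each use. Reductions on multisets of atomic formulas: (LP-Unif) $\Phi\vdash\{A_1,\dots,A_i,\dots,A_n\}\leadsto\{\gamma A_1,\dots,\gamma B_1,\dots,\gamma B_m,\dots,\gamma A_n\}$ if $\kappa:\forall\underline{x}.B_1,\dots,B_m\Rightarrow C\in\Phi$ and $\gamma$ is a most general unifier of $C$ and $A_i$; (term-matching) $\Phi\vdash\{A_1,\dots,A_i,\dots,A_n\}\to\{A_1,\dots,\sigma B_1,\dots,\sigma B_m,\dots,A_n\}$ if $\kappa:\forall\underline{x}.B_1,\dots,B_m\Rightarrow C\in\Phi$ and $\sigma C\equiv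 A_i$; (substitutional) $\Phi\vdash\{A_1,\dots,A_i,\dots,A_n\}\hookrightarrow\{\gamma A_1,\dots,\gamma A_i,\dots,\gamma A_n\}$ if $\kappa:\forall\underline{x}.B_1,\dots,B_m\Rightarrow C\in\Phi$ and $\gamma$ is a most general unifier of $C$ and $A_i$. $\leadsto^*,\to^*$ are reflexive–transitive closures; $\to^\mu$ denotes a $\to$-reduction path to a $\to$-normal form (an infinite path if none exists); $\hookrightarrow^1$ denotes at most one $\hookrightarrow$ step; LP-Struct is $\to^\mu\cdot\hookrightarrow^1$. $\Phi$ is productive if every $\to$-reduction is finite. $\Phi$ is non-overlapping if for any two formulas $\forall\underline{x}.\underline{B}\Rightarrow C$ and $\forall\underline{x}.\underline{D}\Rightarrow E$ in $\Phi$ there are no substitutions $\sigma,\delta$ with $\sigma C\equiv\delta E$.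
   Formalization: In (1) the two occurrences of {C_1,…,C_l} agree only up to renaming of variables; a nonempty (→^μ·↪^1)* path must end with a →^μ normalization, not just after ↪; term-matching does not instantiate variables occurring only in a clause body. The literal claims are false. *)

(* Defs.v *)
(* Equality and choice on atoms are the classical ones of boolp, so that
   multisets of atoms can be finmap multisets over symbols of arbitrary type. *)
From HB Require Import structures.
From Stdlib Require Import Relation_Operators.
From mathcomp Require Import all_boot.
From mathcomp Require Import finmap multiset.
From mathcomp Require Import boolp.

Set Implicit Arguments.
Unset Strict Implicit.
Unset Printing Implicit Defensive.

Local Open Scope mset_scope.

Record signature := Signature {
  fsym : Type; far : fsym -> nat;
  psym : Type; par : psym -> nat }.

Inductive term (S : signature) : Type :=
| Var of nat
| Fun (f : fsym S) of {ffun 'I_(far f) -> term S}.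
Arguments Var {S} _.

(* The induction principle generated for [term] gives no hypothesis on the
   arguments of [Fun]; this is the expected one. *)
Lemma term_full_ind (S : signature) (P : term S -> Prop) :
  (forall x, P (Var x)) ->
  (forall f (ts : {ffun 'I_(far f) -> term S}), (forall i, P (ts i)) ->
     P (Fun ts)) ->
  forall t, P t.
Proof. by move=> PV PF; fix IH 1 => -[x|f ts]; [apply: PV | apply/PF=> i; apply: IH]. Qed.

Record atom (S : signature) : Type :=
  Atom { apred : psym S; aargs : {ffun 'I_(par apred) -> term S} }.

HB.instance Definition _ (S : signature) := gen_eqMixin (atom S).
HB.instance Definition _ (S : signature) := gen_choiceMixin (atom S).

(* The closed formula [forall x. hbody => hhead]: every variable occurring in it
   is bound. *)
Record horn (S : signature) : Type :=
  Horn { hbody : seq (atom S); hhead : atom S }.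

HB.instance Definition _ (S : signature) := gen_eqMixin (horn S).

Record program (S : signature) (K : eqType) : Type := Program {
  clauses :> seq (K * horn S);
  _ : uniq (unzip1 clauses) }.

Definition goal (S : signature) : Type := {mset (atom S)}.

Section Syntax.
Variable S : signature.

Definition substitution : Type := nat -> term S.

Fixpoint tvars (t : term S) : seq nat :=
  match t with
  | Var x => [:: x]
  | Fun f ts => flatten [seq tvars (ts i) | i <- enum 'I_(far f)]
  end.

Definition avars (A : atom S) : seq nat :=
  flatten [seq tvars (aargs A i) | i <- enum 'I_(par (apred A))].

Definition hvars (h : horn S) : seq nat :=
  flatten [seq avars B | B <- hbody h] ++ avars (hhead h).

Definition gvars (G : goal S) : seq nat :=
  flatten [seq avars A | A <- enum_mset G].

Fixpoint tsubst (s : substitution) (t : term S) : term S :=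
  match t with
  | Var x => s x
  | Fun f ts => Fun [ffun i => tsubst s (ts i)]
  end.

Definition asubst (s : substitution) (A : atom S) : atom S :=
  Atom [ffun i => tsubst s (aargs A i)].

Definition hsubst (s : substitution) (h : horn S) : horn S :=
  Horn [seq asubst s B | B <- hbody h] (asubst s (hhead h)).

Definition gsubst (s : substitution) (G : goal S) : goal S :=
  seq_mset [seq asubst s A | A <- enum_mset G].

Definition ren (r : nat -> nat) : substitution := fun x => Var (r x).

(* Equality up to a renaming of variables. *)
Definition variant (G G' : goal S) : Prop :=
  exists r : nat -> nat, bijective r /\ G' = gsubst (ren r) G.

(* "g is more general than d" is required on all variables, so that a most
   general unifier does not instantiate variables foreign to C and A. *)
Definition mgu (g : substitution) (C A : atom S) : Prop :=
  asubst g C = asubst g A /\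
  forall d : substitution, asubst d C = asubst d A ->
    exists t : substitution, forall x, d x = tsubst t (g x).

(* The domain of a matcher is contained in the variables of the pattern: the
   variables of a clause that occur only in its body are not instantiated by
   matching its head. *)
Definition matcher (s : substitution) (C A : atom S) : Prop :=
  asubst s C = A /\ forall x, x \notin avars C -> s x = Var x.

End Syntax.

Section Reductions.
Variables (S : signature) (K : eqType) (Phi : program S K).

(* h is a formula of Phi whose quantified variables are renamed apart from G. *)
Definition renamed_apart (G : goal S) (h : horn S) : Prop :=
  exists (k : K) (h0 : horn S) (r : nat -> nat),
    [/\ (k, h0) \in clauses Phi, bijective r, h = hsubst (ren S r) h0
      & forall x, x \in hvars h -> x \notin gvars G].

Definition unif_step (G G' : goal S) : Prop :=
  exists (A : atom S) (R : goal S) (h : horn S) (g : substitution S),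
    [/\ G = A +` R, renamed_apart G h, mgu g (hhead h) A
      & G' = gsubst g (seq_mset (hbody h) `+` R)].

Definition match_step (G G' : goal S) : Prop :=
  exists (A : atom S) (R : goal S) (h : horn S) (s : substitution S),
    [/\ G = A +` R, renamed_apart G h, matcher s (hhead h) A
      & G' = gsubst s (seq_mset (hbody h)) `+` R].

Definition subst_step (G G' : goal S) : Prop :=
  exists (A : atom S) (R : goal S) (h : horn S) (g : substitution S),
    [/\ G = A +` R, renamed_apart G h, mgu g (hhead h) A
      & G' = gsubst g G].

Definition unif_steps : goal S -> goal S -> Prop := clos_refl_trans _ unif_step.
Definition match_steps : goal S -> goal S -> Prop := clos_refl_trans _ match_step.

Definition match_normal (G : goal S) : Prop := ~ exists G', match_step G G'.

Definition match_nf (G N : goal S) : Prop := match_steps G N /\ match_normal N.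

Definition subst_opt (G G' : goal S) : Prop := G = G' \/ subst_step G G'.

Definition struct_step (G G' : goal S) : Prop :=
  exists N, match_nf G N /\ subst_opt N G'.

(* A finite LP-Struct reduction: a nontrivial one has the shape
   mu . subst . mu . subst . ... . mu, i.e. it does not stop between a
   substitutional step and the term-matching normalization following it.
   (The plain closure of struct_step would also contain, for the one-clause
   program q(y) => p(f(y)), the reduction of {p(x)} to {p(f(y))}, which is not
   an LP-Unif reduction.) *)
Definition struct_steps (G G' : goal S) : Prop :=
  G = G' \/ exists N, clos_refl_trans _ struct_step G N /\ match_nf N G'.

Definition productive : Prop :=
  ~ exists G : nat -> goal S, forall n, match_step (G n) (G n.+1).

Definition non_overlapping : Prop :=
  forall (k1 k2 : K) (h1 h2 : horn S),
    (k1, h1) \in clauses Phi -> (k2, h2) \in clauses Phi -> k1 != k2 ->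
    ~ exists s d : substitution S, asubst s (hhead h1) = asubst d (hhead h2).

End Reductions.

(* Main.v *)
(* Up to a renaming of the fresh variables, term-matching steps are stable under
   substitution and, for a non-overlapping program, have the diamond property, so
   every term-matching path out of a goal can be completed to each of its normal
   forms.  Matchers are most general unifiers, hence matching steps are LP-Unif
   steps; and the atom instantiated by a substitutional step by the head of a
   clause can next be matched by this clause, the two steps together being one
   LP-Unif step.  Conversely, an LP-Unif step on an atom that some clause matches
   is a variant of a matching step; on any other atom it commutes with the
   normalization of the rest of the goal.  The renamings are harmless for part (2)
   because a most general unifier may be composed with any renaming, so that the
   last LP-Unif step of a nonempty reduction absorbs them. *)
From Stdlib Require Import Relation_Operators Operators_Properties Eqdep.
From mathcomp Require Import all_boot.
From mathcomp Require Import finmap multiset boolp.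
Require Import Defs.

Set Implicit Arguments.
Unset Strict Implicit.
Unset Printing Implicit Defensive.

Local Open Scope mset_scope.

(** * Finite injections of variables and fresh names *)

(** Renamings are required to be bijective, while constructions below fix only finitely many values.
    In the induction, the transposition of [r x] and [f x] corrects the value at [x] and leaves the
    values on [s] alone, by injectivity of [r] and [f]. *)
Lemma extend_injection (s : seq nat) (f : nat -> nat) :
  {in s &, injective f} -> exists2 r : nat -> nat, bijective r & {in s, r =1 f}.
Proof.
elim: s => [|x s IHs] inj_f; first by exists id => //; exists id.
have [|r [r' rK r'K] r_f] := IHs.
  by move=> y z ys zs; apply: inj_f; rewrite inE ?ys ?zs orbT.
pose swap y := if y == r x then f x else if y == f x then r x else y.
have swapK : involutive swap.
  rewrite /swap => y; case: (eqVneq y (r x)) => [->|y_rx].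
    by rewrite eqxx; case: eqVneq.
  by case: (eqVneq y (f x)) => [->|/negPf y_fx]; rewrite ?eqxx ?(negPf y_rx) ?y_fx.
exists (swap \o r).
  by apply: bij_comp; [exists swap | exists r'].
move=> y; rewrite inE /swap /=.
have [->|y_x] /= := eqVneq y x; first by rewrite eqxx.
move=> ys; have /negPf -> : r y != r x.
  by apply: contraNneq y_x => /(can_inj rK) ->.
have /negPf : r y != f x.
  rewrite r_f //; apply: contraNneq y_x => /inj_f -> //; rewrite !inE ?eqxx //.
  by rewrite ys orbT.
by rewrite r_f // => ->.
Qed.

(** A single offset provides an injective supply of fresh names. *)
Lemma fresh_shift (s : seq nat) : exists m, forall x, x + m \notin s.
Proof.
exists (\max_(y <- s) y).+1 => x; apply/negP => xs.
have : x + (\max_(y <- s) y).+1 <= \max_(y <- s) y.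
  by rewrite -[leqLHS]/(id _) (@leq_bigmax_seq _ _ xpredT id).
by rewrite addnS leqNgt ltnS leq_addl.
Qed.

(** * Substitution calculus on terms, atoms and goals; variants *)

Section Substitutions.
Variable S : signature.
Implicit Types (s : substitution S) (t : term S) (A : atom S) (G : goal S).
Implicit Types h : horn S.

Definition scomp s s' : substitution S := fun x => tsubst s (s' x).

Lemma mem_tvars_fun (f : fsym S) (ts : {ffun 'I_(far f) -> term S}) x :
  reflect (exists i, x \in tvars (ts i)) (x \in tvars (Fun ts)).
Proof.
apply: (iffP flatten_mapP) => [[i _ xi]|[i xi]]; exists i => //.
by rewrite mem_enum.
Qed.

Lemma mem_avars A x :
  reflect (exists i, x \in tvars (aargs A i)) (x \in avars A).
Proof.
apply: (iffP flatten_mapP) => [[i _ xi]|[i xi]]; exists i => //.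
by rewrite mem_enum.
Qed.

Lemma mem_gvars G x : reflect (exists2 A, A \in G & x \in avars A) (x \in gvars G).
Proof.
by apply: (iffP flatten_mapP) => -[A AG xA]; exists A; rewrite // -?topredE.
Qed.

Lemma tsubst_eqP s s' t :
  tsubst s t = tsubst s' t <-> {in tvars t, s =1 s'}.
Proof.
elim/term_full_ind: t => [x|f ts IHt] /=.
  by split=> [eq_x y|]; [rewrite inE => /eqP -> | apply; rewrite inE].
split=> [[eq_ts] x /mem_tvars_fun[i]|eq_s].
  (* The type of the arguments depends on the symbol, so injectivity of [Fun] yields only an
     equality of dependent pairs. *)
  apply: (IHt i).1; move: (inj_pair2 _ _ _ _ _ eq_ts).
  by move/(congr1 (fun u : {ffun _ -> _} => u i)); rewrite !ffunE.
congr Fun; apply/ffunP => i; rewrite !ffunE; apply/IHt => x xi.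
by apply: eq_s; apply/mem_tvars_fun; exists i.
Qed.

Lemma asubst_eqP s s' A :
  asubst s A = asubst s' A <-> {in avars A, s =1 s'}.
Proof.
split=> [[eq_A] x /mem_avars[i]|eq_s].
  apply: (tsubst_eqP _ _ _).1; move: (inj_pair2 _ _ _ _ _ eq_A).
  by move/(congr1 (fun u : {ffun _ -> _} => u i)); rewrite !ffunE.
congr Atom; apply/ffunP => i; rewrite !ffunE; apply/tsubst_eqP => x xi.
by apply: eq_s; apply/mem_avars; exists i.
Qed.

Lemma tsubst_comp s s' t : tsubst s (tsubst s' t) = tsubst (scomp s s') t.
Proof.
elim/term_full_ind: t => [x|f ts IHt] //=.
by congr Fun; apply/ffunP => i; rewrite !ffunE.
Qed.

Lemma asubst_comp s s' A : asubst s (asubst s' A) = asubst (scomp s s') A.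
Proof. by congr Atom; apply/ffunP => i; rewrite !ffunE /= tsubst_comp. Qed.

Lemma tsubst_id t : tsubst Var t = t.
Proof.
elim/term_full_ind: t => [x|f ts IHt] //=.
by congr Fun; apply/ffunP => i; rewrite !ffunE.
Qed.

Lemma asubst_id A : asubst Var A = A.
Proof.
by case: A => p ts; congr Atom; apply/ffunP => i; rewrite !ffunE /= tsubst_id.
Qed.

Lemma asubst_fix s A : {in avars A, forall x, s x = Var x} -> asubst s A = A.
Proof. by move=> s_id; rewrite -[RHS]asubst_id; apply/asubst_eqP. Qed.

Lemma tvars_tsubst s t x :
  reflect (exists2 y, y \in tvars t & x \in tvars (s y)) (x \in tvars (tsubst s t)).
Proof.
apply: (iffP idP).
  elim/term_full_ind: t => [y|f ts IHt] /=; first by exists y; rewrite ?inE.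
  case/mem_tvars_fun => i; rewrite ffunE => /IHt[y yi xy].
  by exists y => //; apply/mem_tvars_fun; exists i.
elim/term_full_ind: t => [y|f ts IHt] /= [z].
  by rewrite inE => /eqP ->.
case/mem_tvars_fun => i zi xz; apply/mem_tvars_fun; exists i.
by rewrite ffunE; apply: IHt; exists z.
Qed.

Lemma avars_asubst s A x :
  reflect (exists2 y, y \in avars A & x \in tvars (s y)) (x \in avars (asubst s A)).
Proof.
apply: (iffP (mem_avars _ _)) => [[i]|[y /mem_avars[i yi] xy]].
  by rewrite ffunE => /tvars_tsubst[y yi xy]; exists y => //; apply/mem_avars; exists i.
by exists i; rewrite ffunE; apply/tvars_tsubst; exists y.
Qed.

Lemma in_seq_mset (l : seq (atom S)) A : (A \in seq_mset l) = (A \in l).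
Proof. exact: (perm_mem (perm_eq_seq_mset l)). Qed.

Lemma gsubst_seq s (l : seq (atom S)) :
  gsubst s (seq_mset l) = seq_mset [seq asubst s A | A <- l].
Proof. by apply/eq_seq_msetP/perm_map/perm_eq_seq_mset. Qed.

Lemma seq_msetD (l l' : seq (atom S)) : seq_mset (l ++ l') = seq_mset l `+` seq_mset l'.
Proof. by apply/msetP => A; rewrite msetE2 !mset_seqE count_cat. Qed.

Lemma gsubstD s G G' : gsubst s (G `+` G') = gsubst s G `+` gsubst s G'.
Proof.
rewrite -[G]seq_mset_id -[G']seq_mset_id -seq_msetD !gsubst_seq map_cat seq_msetD.
by rewrite -!gsubst_seq.
Qed.

Lemma gsubst1 s A : gsubst s [mset A] = [mset asubst s A].
Proof.
have seq1 B : [mset B] = seq_mset [:: B].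
  by apply/msetP => C; rewrite msetnE mset_seqE /= addn0 eq_sym; case: eqP.
by rewrite seq1 gsubst_seq seq1.
Qed.

Lemma gsubst1D s A G : gsubst s (A +` G) = asubst s A +` gsubst s G.
Proof. by rewrite gsubstD gsubst1. Qed.

Lemma gsubst_ext s s' G : {in gvars G, s =1 s'} -> gsubst s G = gsubst s' G.
Proof.
move=> eq_s; apply/eq_seq_msetP; rewrite (@eq_in_map _ _ (asubst s) (asubst s') _).1 // => A AG.
by apply/asubst_eqP => x xA; apply: eq_s; apply/mem_gvars; exists A; rewrite // -topredE.
Qed.

Lemma gsubst_comp s s' G : gsubst s (gsubst s' G) = gsubst (scomp s s') G.
Proof.
rewrite gsubst_seq -map_comp; congr seq_mset; apply: eq_map => A.
exact: asubst_comp.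
Qed.

Lemma gsubst_id G : gsubst Var G = G.
Proof.
rewrite -[RHS]seq_mset_id; congr seq_mset; rewrite -[RHS]map_id.
by apply: eq_map => A; rewrite asubst_id.
Qed.

Lemma gsubst_fix s G : {in gvars G, forall x, s x = Var x} -> gsubst s G = G.
Proof. by move=> s_id; rewrite -[RHS]gsubst_id; apply: gsubst_ext. Qed.

Lemma mem_gsubst s G A : reflect (exists2 B, B \in G & A = asubst s B) (A \in gsubst s G).
Proof.
rewrite in_seq_mset.
by apply: (iffP mapP) => -[B BG ->]; exists B; rewrite // -topredE.
Qed.

Lemma gvars_gsubst s G x :
  reflect (exists2 y, y \in gvars G & x \in tvars (s y)) (x \in gvars (gsubst s G)).
Proof.
apply: (iffP (mem_gvars _ _)).
  case=> _ /mem_gsubst[A AG ->] /avars_asubst[y yA xy].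
  by exists y => //; apply/mem_gvars; exists A.
case=> y /mem_gvars[A AG yA] xy; exists (asubst s A).
  by apply/mem_gsubst; exists A.
by apply/avars_asubst; exists y.
Qed.

Lemma gvarsD G G' x : (x \in gvars (G `+` G')) = (x \in gvars G) || (x \in gvars G').
Proof.
apply/mem_gvars/orP => [[A /msetDP[AG|AG] xA]|[] /mem_gvars[A AG xA]].
- by left; apply/mem_gvars; exists A.
- by right; apply/mem_gvars; exists A.
- by exists A => //; apply/msetDP; left.
- by exists A => //; apply/msetDP; right.
Qed.

Lemma gvars1 A x : (x \in gvars [mset A]) = (x \in avars A).
Proof.
apply/mem_gvars/idP => [[B /mset1P ->] //|xA].
by exists A => //; apply/mset1P.
Qed.

Lemma gvars1D A G x : (x \in gvars (A +` G)) = (x \in avars A) || (x \in gvars G).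
Proof. by rewrite gvarsD gvars1. Qed.

Lemma gvars_body h x : x \in gvars (seq_mset (hbody h)) -> x \in hvars h.
Proof.
case/mem_gvars => A; rewrite in_seq_mset => Ah xA.
by rewrite mem_cat; apply/orP; left; apply/flatten_mapP; exists A.
Qed.

Lemma avars_head h x : x \in avars (hhead h) -> x \in hvars h.
Proof. by move=> xh; rewrite mem_cat xh orbT. Qed.

Lemma avars_ren r A x :
  reflect (exists2 y, y \in avars A & x = r y) (x \in avars (asubst (ren S r) A)).
Proof.
apply: (iffP (avars_asubst _ _ _)) => -[y yA]; first by rewrite inE => /eqP; exists y.
by move=> ->; exists y; rewrite ?inE.
Qed.

Lemma gvars_ren r G x :
  reflect (exists2 y, y \in gvars G & x = r y) (x \in gvars (gsubst (ren S r) G)).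
Proof.
apply: (iffP (gvars_gsubst _ _ _)) => -[y yA]; first by rewrite inE => /eqP; exists y.
by move=> ->; exists y; rewrite ?inE.
Qed.

Lemma hvars_ren r h x :
  reflect (exists2 y, y \in hvars h & x = r y) (x \in hvars (hsubst (ren S r) h)).
Proof.
rewrite mem_cat; apply: (iffP orP).
  case=> [/flatten_mapP[_ /mapP[A Ah ->]] | ] /avars_ren[y yA ->]; exists y => //.
    by rewrite mem_cat; apply/orP; left; apply/flatten_mapP; exists A.
  exact: avars_head.
case=> y; rewrite mem_cat => /orP[/flatten_mapP[A Ah yA]|yh] ->; last first.
  by right; apply/avars_ren; exists y.
left; apply/flatten_mapP; exists (asubst (ren S r) A); first exact: map_f.
by apply/avars_ren; exists y.
Qed.

Lemma gsubst_body s (s' : substitution S) h :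
  {in hvars h, s' =1 s} -> gsubst s' (seq_mset (hbody h)) = gsubst s (seq_mset (hbody h)).
Proof. by move=> eq_s; apply: gsubst_ext => x /gvars_body; apply: eq_s. Qed.

Lemma variant_refl G : variant G G.
Proof. by exists id; split; [exists id | rewrite gsubst_id]. Qed.

Lemma variant_sym G G' : variant G G' -> variant G' G.
Proof.
case=> r [[r' rK r'K] ->]; exists r'; split; first by exists r.
rewrite gsubst_comp gsubst_fix // => x _.
by rewrite /scomp /ren /= rK.
Qed.

Lemma variant_trans G2 G1 G3 : variant G1 G2 -> variant G2 G3 -> variant G1 G3.
Proof.
case=> r [bij_r ->] [r' [bij_r' ->]]; exists (r' \o r); split; first exact: bij_comp.
by rewrite gsubst_comp.
Qed.

Lemma variant_inj G (f : nat -> nat) :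
  {in gvars G &, injective f} -> variant G (gsubst (ren S f) G).
Proof.
case/extend_injection => r bij_r eq_r; exists r; split=> //.
by apply: gsubst_ext => x xG; rewrite /ren eq_r.
Qed.

End Substitutions.

(** * Most general unifiers *)

Section Unifiers.
Variable S : signature.
Implicit Types (g s d : substitution S) (A C : atom S) (G : goal S).

(** The default 0 is harmless: the result matters only for terms shown to be variables. *)
Definition var_of (t : term S) : nat := if t is Var z then z else 0.

(* The value of a most general unifier at a foreign variable can be changed at
   will, so it must be a variable occurring in no other value. *)
Lemma mgu_outside g C A x :
  mgu g C A -> x \notin avars C -> x \notin avars A ->
  g x = Var (var_of (g x)) /\ forall y, y != x -> var_of (g x) \notin tvars (g y).
Proof.
case=> unif_g mgu_g xC xA.
have retract u : exists t, tsubst t (g x) = u /\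
    forall y, y != x -> tsubst t (g y) = g y.
  pose d y := if y == x then u else g y.
  have d_out B : x \notin avars B -> asubst d B = asubst g B.
    move=> xB; apply/asubst_eqP => y yB; rewrite /d; case: eqP yB xB => // ->.
    by move=> ->.
  have [|t d_t] := mgu_g d; first by rewrite !d_out.
  exists t; split=> [|y /negPf y_x]; first by rewrite -d_t /d eqxx.
  by rewrite -d_t /d y_x.
have gxE : g x = Var (var_of (g x)).
  by have [t [+ _]] := retract (Var 0); case: (g x).
(* The successor is just another variable: a substitution that moves [var_of (g x)] to it yet fixes
   [g y] shows that [var_of (g x)] does not occur in [g y]. *)
split=> // y y_x; have [t [+ /(_ y y_x)]] := retract (Var (var_of (g x)).+1).
rewrite {1}gxE /= => tz; rewrite -[RHS]tsubst_id => /tsubst_eqP t_id.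
apply/negP => /t_id; rewrite tz => -[] /eqP.
by rewrite eqn_leq ltnn.
Qed.

(** The two unifiers factor through each other by [t] and [t']. On the variables of [gsubst g G] the
    composite of [t'] after [t] is the identity, so [t] is an injective renaming there, which
    extends to a bijection. *)
Lemma mgu_variant g s C A G :
  mgu g C A -> mgu s C A -> variant (gsubst g G) (gsubst s G).
Proof.
move=> [unif_g mgu_g] [unif_s mgu_s].
have [t s_t] := mgu_g _ unif_s; have [t' g_t'] := mgu_s _ unif_g.
have tK z : z \in gvars (gsubst g G) -> tsubst t' (t z) = Var z.
  case/gvars_gsubst => y _; move: z; apply/tsubst_eqP.
  by rewrite -/(scomp t' t) -tsubst_comp -s_t -g_t' tsubst_id.
pose f z := var_of (t z).
have tE z : z \in gvars (gsubst g G) -> t z = Var (f z).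
  by rewrite /f => /tK; case: (t z).
have -> : gsubst s G = gsubst (ren S f) (gsubst g G).
  rewrite -(gsubst_ext tE) gsubst_comp; apply: gsubst_ext => y _; exact: s_t.
apply: variant_inj => y z yG zG f_yz.
by have := tK y yG; rewrite tE // f_yz -tE // tK // => -[].
Qed.

Lemma mgu_ren g C A (r : nat -> nat) :
  bijective r -> mgu g C A -> mgu (scomp (ren S r) g) C A.
Proof.
case=> r' rK _ [unif_g mgu_g]; split; first by rewrite -!asubst_comp unif_g.
move=> d /mgu_g[t d_t]; exists (scomp t (ren S r')) => x.
rewrite d_t /scomp tsubst_comp; apply/tsubst_eqP => y _.
by rewrite /scomp /= rK.
Qed.

(** Every unifier [d] factors through [s] by [d] itself: on the variables of [C] because [s] maps
    [C] to [A] and [d] unifies the two, elsewhere because [s] is the identity. *)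
Lemma matcher_mgu s C A :
  (forall x, x \in avars C -> x \notin avars A) -> matcher s C A -> mgu s C A.
Proof.
move=> disj [match_s s_id]; split.
  rewrite match_s asubst_fix // => x xA; apply: s_id.
  by apply: contraL xA; apply: disj.
move=> d unif_d; exists d => x; case: (boolP (x \in avars C)) => [|/s_id -> //].
by move: x; apply/asubst_eqP; rewrite -/(scomp d s) -asubst_comp match_s.
Qed.

End Unifiers.

(** This is the case distinction for two steps out of one goal: same selected atom, or two separate
    ones with a common remainder. *)
Lemma mset1D_eq (T : choiceType) (a b : T) (A B : {mset T}) :
  a +` A = b +` B ->
  a = b /\ A = B \/ exists C : {mset T}, A = b +` C /\ B = a +` C.
Proof.
move=> eqAB; have [eq_ab|a_b] := eqVneq a b.
  by left; split=> //; rewrite -[A](msetD1K a) eqAB eq_ab msetD1K.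
right; have bA : b \in A.
  by have := mset1D1 b B; rewrite -eqAB in_mset1D eq_sym (negPf a_b).
exists (A `\ b); rewrite msetB1K //; split=> //.
by rewrite -[B](msetD1K b) -eqAB -{1}(msetB1K bA) msetDCA msetD1K.
Qed.

(** * Term-matching steps: choice of fresh names and stability under substitution *)

Section Matching.
Variables (S : signature) (K : eqType) (Phi : program S K).
Implicit Types (G R : goal S) (A : atom S) (h : horn S) (s t : substitution S).

(** These are the variables that matching the head leaves uninstantiated, hence the source of the
    fresh variables of a contractum. *)
Definition body_vars h : seq nat := [seq x <- hvars h | x \notin avars (hhead h)].

Lemma mem_body_vars h x :
  (x \in body_vars h) = (x \notin avars (hhead h)) && (x \in hvars h).
Proof. exact: mem_filter. Qed.

(* [t] is a matcher composed with the renaming of the clause [h] of the program;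
   [e] is the part of the renaming that survives in the contractum. *)
Definition fresh_instance G h t (e : nat -> nat) : Prop :=
  [/\ {in body_vars h, forall x, t x = Var (e x)}, {in body_vars h &, injective e}
    & {in body_vars h, forall x, e x \notin gvars G}].

Lemma match_step_intro k h A R t e :
  (k, h) \in clauses Phi -> asubst t (hhead h) = A -> fresh_instance (A +` R) h t e ->
  match_step Phi (A +` R) (gsubst t (seq_mset (hbody h)) `+` R).
Proof.
move=> kh tA [tE inj_e fresh_e].
have [m fresh_m] := fresh_shift (gvars (A +` R) ++ [seq e x | x <- body_vars h]).
(* The renaming of the clause must follow [e] on body-only variables; the head variables go to
   unrelated fresh names, since the matcher overwrites them. *)
pose f x := if x \in body_vars h then e x else x + m.
have inj_f : {in hvars h &, injective f}.
  have e_m x y : x \in body_vars h -> e x != y + m.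
    move=> xh; have := fresh_m y; rewrite mem_cat negb_or => /andP[_].
    by apply: contraNneq => <-; apply: map_f.
  move=> x y _ _; rewrite /f; case: ifPn => xh; case: ifPn => yh.
  - exact: inj_e.
  - by move/eqP; rewrite (negPf (e_m _ _ _)).
  - by move/esym/eqP; rewrite (negPf (e_m _ _ _)).
  - exact: addIn.
have [r [r' rK r'K] r_f] := extend_injection inj_f.
(* The matcher undoes the renaming on head variables before applying [t]. *)
pose s z := if r' z \in avars (hhead h) then t (r' z) else Var z.
have sE x : x \in hvars h -> s (r x) = t x.
  move=> xh; rewrite /s rK; case: ifPn => // xh'.
  have xb : x \in body_vars h by rewrite mem_body_vars xh' xh.
  by rewrite r_f // /f xb tE.
exists A, R, (hsubst (ren S r) h), s; split=> //.
- exists k, h, r; split=> //; first by exists r'.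
  move=> _ /hvars_ren[x xh ->]; rewrite r_f // /f; case: ifPn => [/fresh_e //|_].
  by have := fresh_m x; rewrite mem_cat negb_or => /andP[].
- split; last by move=> x /avars_ren xh; rewrite /s; case: ifPn => // x'h; case: xh; exists (r' x).
  rewrite /= asubst_comp -tA; apply/asubst_eqP => x /avars_head xh.
  exact: sE.
- congr (_ `+` _); rewrite /= -gsubst_seq gsubst_comp.
  by apply/esym/gsubst_body => x xh; apply: sE.
Qed.

Lemma match_step_elim G G' :
  match_step Phi G G' -> exists k h A R t e,
    [/\ (k, h) \in clauses Phi, G = A +` R, asubst t (hhead h) = A,
        fresh_instance (A +` R) h t e
      & G' = gsubst t (seq_mset (hbody h)) `+` R].
Proof.
case=> A [R [h [s [-> [k [h0 [r [kh0 bij_r -> fresh_r]]]] [match_s s_id] ->]]]].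
have inj_r := bij_inj bij_r.
exists k, h0, A, R, (scomp s (ren S r)), r; split=> //.
- by rewrite -asubst_comp.
- split=> [x|x y _ _ /inj_r //|x]; rewrite mem_body_vars => /andP[xh0 xh].
    apply: s_id; apply/negP => /avars_ren[y yh0 /inj_r xy].
    by rewrite xy yh0 in xh0.
  by apply: fresh_r; apply/hvars_ren; exists x.
- by rewrite /= -gsubst_seq gsubst_comp.
Qed.

Lemma tvars_head_instance h t A x y :
  asubst t (hhead h) = A -> x \in hvars h -> x \notin body_vars h ->
  y \in tvars (t x) -> y \in avars A.
Proof.
move=> <- xh; rewrite mem_body_vars xh andbT negbK => xhead yx.
by apply/avars_asubst; exists x.
Qed.

Lemma gvars_contractum A R h t e y :
  asubst t (hhead h) = A -> {in body_vars h, forall x, t x = Var (e x)} ->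
  y \in gvars (gsubst t (seq_mset (hbody h)) `+` R) ->
  y \in gvars (A +` R) \/ exists2 x, x \in body_vars h & y = e x.
Proof.
move=> tA tE; rewrite gvarsD gvars1D => /orP[|->]; last by left; rewrite orbT.
case/gvars_gsubst => x /gvars_body xh yx.
case: (boolP (x \in body_vars h)) => xb; last first.
  by left; rewrite (tvars_head_instance tA xh xb yx).
by right; exists x => //; move: yx; rewrite tE // inE => /eqP.
Qed.

(** The fresh names of a step can be rechosen at the price of a variant: exchanging [e x] for [e' x]
    and fixing the variables of the goal is injective on the contractum. *)
Lemma refresh_instance A R h t e (e' : nat -> nat) :
  asubst t (hhead h) = A -> fresh_instance (A +` R) h t e ->
  {in body_vars h &, injective e'} ->
  {in body_vars h, forall x, e' x \notin gvars (A +` R)} ->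
  exists t', [/\ asubst t' (hhead h) = A, fresh_instance (A +` R) h t' e',
    {in hvars h, forall x, x \notin body_vars h -> t' x = t x}
    & variant (gsubst t (seq_mset (hbody h)) `+` R)
              (gsubst t' (seq_mset (hbody h)) `+` R)].
Proof.
move=> tA [tE inj_e fresh_e] inj_e' fresh_e'.
pose t' x := if x \in body_vars h then Var (e' x) else t x.
have t'head : asubst t' (hhead h) = A.
  rewrite -tA; apply/asubst_eqP => x xh.
  by rewrite /t' mem_body_vars xh.
exists t'; split=> //.
- by split=> // x xh; rewrite /t' xh.
- by move=> x _ /negPf xh; rewrite /t' xh.
(* The index recovers a preimage under [e]; the default 0 is reached only at variables absent from
   the contractum. *)
pose f z := if z \in gvars (A +` R) then z
            else e' (nth 0 (body_vars h) (index z [seq e x | x <- body_vars h])).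
have fE x : x \in body_vars h -> f (e x) = e' x.
  move=> xh; rewrite /f (negPf (fresh_e x xh)); congr e'.
  have ex := map_f e xh; have lt_i := ex; rewrite -index_mem size_map in lt_i.
  by apply: inj_e => //; rewrite ?mem_nth // -(nth_map _ 0) // nth_index.
have f_id z : z \in gvars (A +` R) -> f z = z by rewrite /f => ->.
set G1 := _ `+` R.
have -> : gsubst t' (seq_mset (hbody h)) `+` R = gsubst (ren S f) G1.
  rewrite gsubstD gsubst_comp; congr (_ `+` _); last first.
    rewrite gsubst_fix // => x xR; rewrite /ren f_id //.
    by rewrite gvars1D xR orbT.
  apply: gsubst_body => x xh; rewrite /t' /scomp; case: ifPn => xb.
    by rewrite tE //= /ren fE.
  rewrite -[LHS]tsubst_id; apply/tsubst_eqP => y /(tvars_head_instance tA xh xb) yA.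
  by rewrite /ren f_id // gvars1D yA.
apply: variant_inj => y z /(gvars_contractum tA tE) yG /(gvars_contractum tA tE) zG.
case: yG zG => [yG|[x xh ->]] [zG|[x' x'h ->]].
- by rewrite !f_id.
- by rewrite (f_id y) // fE // => y_x'; have := fresh_e' _ x'h; rewrite -y_x' yG.
- by rewrite (f_id z) // fE // => x_z; have := fresh_e' _ xh; rewrite x_z zG.
- by rewrite !fE // => /inj_e' ->.
Qed.

(** The step is repeated with [scomp s t] on the same clause. The conditions on [e'] say that [s]
    merely renames the fresh variables and keeps them fresh; they are met below by renamings and by
    most general unifiers. *)
Lemma match_step_gsubst k h A R t e s (e' : nat -> nat) :
  (k, h) \in clauses Phi -> asubst t (hhead h) = A ->
  {in body_vars h, forall x, t x = Var (e x)} ->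
  {in body_vars h, forall x, s (e x) = Var (e' x)} ->
  {in body_vars h &, injective e'} ->
  {in body_vars h, forall x, e' x \notin gvars (gsubst s (A +` R))} ->
  match_step Phi (gsubst s (A +` R)) (gsubst s (gsubst t (seq_mset (hbody h)) `+` R)).
Proof.
move=> kh tA tE sE inj_e'; rewrite gsubst1D gsubstD gsubst_comp => fresh_e'.
apply: (match_step_intro (e := e') kh); first by rewrite -asubst_comp tA.
by split=> // x xh; rewrite /scomp tE //= sE.
Qed.

Lemma match_step_variant G G' H :
  match_step Phi G G' -> variant G H ->
  exists2 H', match_step Phi H H' & variant G' H'.
Proof.
case/match_step_elim => k [h [A [R [t [e [kh -> tA [tE inj_e fresh_e] ->]]]]]].
case=> r [bij_r ->]; have inj_r := bij_inj bij_r.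
exists (gsubst (ren S r) (gsubst t (seq_mset (hbody h)) `+` R)); last by exists r.
apply: (match_step_gsubst (e' := r \o e) kh tA tE) => //.
  by move=> x y xh yh /inj_r; apply: inj_e.
move=> x xh; apply/negP => /gvars_ren[y yG /inj_r xy].
by have := fresh_e _ xh; rewrite xy yG.
Qed.

Lemma match_steps_variant G G' H :
  match_steps Phi G G' -> variant G H ->
  exists2 H', match_steps Phi H H' & variant G' H'.
Proof.
move=> GG'; elim: GG' H => {G G'} [G G' st|G|G G' G'' _ IH1 _ IH2] H GH.
- by have [H' ? ?] := match_step_variant st GH; exists H' => //; apply: rt_step.
- by exists H => //; apply: rt_refl.
- have [H' st1 /IH2[H'' st2 ?]] := IH1 _ GH.
  by exists H'' => //; apply: rt_trans st1 st2.
Qed.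

Lemma clause_inj k h h' :
  (k, h) \in clauses Phi -> (k, h') \in clauses Phi -> h = h'.
Proof.
case: Phi => cs /=; elim: cs => //= -[k1 h1] cs IHcs /andP[k1cs uniq_cs].
have notin h2 : (k1, h2) \in cs -> False.
  by move=> in_cs; move: k1cs; rewrite (map_f (@fst _ _) in_cs).
rewrite !inE => /orP[/eqP[eqk ->]|kh] /orP[/eqP[eqk' ->]|kh'] //.
- by case: (notin h'); rewrite -eqk.
- by case: (notin h); rewrite -eqk'.
- exact: IHcs.
Qed.

(** * Non-overlap and confluence of matching up to variants *)

Hypothesis Hno : non_overlapping Phi.

(** Non-overlap excludes distinct labels; equal labels determine the formula by uniqueness of
    labels. *)
Lemma non_overlapping_clause k k' h h' s s' :
  (k, h) \in clauses Phi -> (k', h') \in clauses Phi ->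
  asubst s (hhead h) = asubst s' (hhead h') -> h = h'.
Proof.
move=> kh kh' eq_s; have [eqk|k_k'] := eqVneq k k'.
  by rewrite eqk in kh; apply: clause_inj kh kh'.
by case: (Hno kh kh' k_k'); exists s, s'.
Qed.

(** On the same atom both steps use the same clause, and giving them the same fresh names makes the
    results equal. On distinct atoms the steps commute once their fresh names are disjoint. *)
Lemma match_step_diamond G G1 G2 :
  match_step Phi G G1 -> match_step Phi G G2 ->
  exists2 G2', variant G2 G2' &
    G1 = G2' \/ exists2 H, match_step Phi G1 H & match_step Phi G2' H.
Proof.
case/match_step_elim => k1 [h1 [A1 [R1 [t1 [e1 [kh1 -> tA1 fr1 ->]]]]]].
case/match_step_elim => k2 [h2 [A2 [R2 [t2 [e2 [kh2 eqG tA2 fr2 ->]]]]]].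
have [tE1 inj_e1 fresh_e1] := fr1.
have [[eqA eqR]|[Q [eqR1 eqR2]]] := mset1D_eq eqG.
  rewrite -{}eqA -{}eqR in tA2 fr2 *.
  have eqh : h1 = h2.
    by apply: (non_overlapping_clause (s := t1) (s' := t2) kh1 kh2); rewrite tA1 tA2.
  subst h2.
  have [t [tA [tE _ _] t_head var_t]] := refresh_instance tA2 fr2 inj_e1 fresh_e1.
  eexists; first exact: var_t.
  left; congr (_ `+` _); apply: gsubst_body => x xh.
  case: (boolP (x \in body_vars h1)) => xb; first by rewrite tE1 // tE.
  rewrite t_head //; move: xb; rewrite mem_body_vars xh andbT negbK.
  by move: x {xh}; apply/asubst_eqP; rewrite tA1.
subst R1 R2; set C1 := gsubst t1 _ `+` _.
(* The new names of the second step avoid the goal and [C1], so that it can be taken before or after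
   the first, and the names [e1 x], so that the first remains possible after it. *)
have [m fresh_m] := fresh_shift (gvars (A1 +` (A2 +` Q)) ++ gvars C1
  ++ [seq e1 x | x <- body_vars h1]).
have {fresh_m} fresh_m x : [/\ x + m \notin gvars (A1 +` (A2 +` Q)),
    x + m \notin gvars C1 & x + m \notin [seq e1 x | x <- body_vars h1]].
  by have := fresh_m x; rewrite !mem_cat !negb_or => /and3P[].
have [||t [tA [tE inj_e fresh_e] _ var_t]] :=
  refresh_instance (e' := addn^~ m) tA2 fr2.
- by move=> x y _ _ /addIn.
- by move=> x _; rewrite -eqG; have [] := fresh_m x.
eexists; first exact: var_t.
right.
exists (gsubst t (seq_mset (hbody h2)) `+` (gsubst t1 (seq_mset (hbody h1)) `+` Q)).
  rewrite /C1 msetDCA; apply: (match_step_intro (e := addn^~ m) kh2 tA); split=> // x _.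
  by have [_ + _] := fresh_m x; rewrite /C1 msetDCA.
rewrite msetDCA (msetDCA _ (gsubst t1 _)).
apply: (match_step_intro (e := e1) kh1 tA1); split=> // x xh.
apply/negP; rewrite -msetDCA => /(gvars_contractum tA tE) [|[y _ e1x]].
  by rewrite -eqG; apply/negP/fresh_e1.
by have [_ _ /negP[]] := fresh_m y; rewrite -e1x; apply: map_f.
Qed.

(** Induction along the path to [N]: each of its steps is joined with the diverging one by the
    diamond, until the two sides merge; they must, because [N] admits no step. *)
Lemma match_nf_step G N G1 :
  match_nf Phi G N -> match_step Phi G G1 ->
  exists2 N', match_steps Phi G1 N' & variant N N'.
Proof.
case=> /clos_rt_rt1n_iff GN nfN; elim: GN nfN G1 => {G N} [N|G G2 N GG2 G2N IH] nfN G1.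
  by move=> st; case: nfN; exists G1.
move=> GG1; have [G1' G1G1' [eqG2|[H G2H G1'H]]] := match_step_diamond GG2 GG1.
  subst G1'; apply: (match_steps_variant _ (variant_sym G1G1')).
  exact/clos_rt_rt1n_iff.
have [N' HN' NN'] := IH nfN _ G2H.
have G1'N' : match_steps Phi G1' N' by apply: rt_trans HN'; apply: rt_step.
have [N'' G1N'' N'N''] := match_steps_variant G1'N' (variant_sym G1G1').
by exists N'' => //; apply: variant_trans N'N''.
Qed.

(** * From LP-Struct to LP-Unif *)

Lemma renamed_apart_disjoint A R h x :
  renamed_apart Phi (A +` R) h -> x \in hvars h ->
  (x \notin avars A) * (x \notin gvars R).
Proof.
case=> k [h0 [r [_ _ _ fresh_h]]] /fresh_h.
by rewrite gvars1D negb_or => /andP[-> ->].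
Qed.

Lemma match_unif_step G G' : match_step Phi G G' -> unif_step Phi G G'.
Proof.
case=> A [R [h [s [-> apart_h match_s ->]]]]; exists A, R, h, s; split=> //.
  apply: matcher_mgu match_s => x /avars_head xh.
  by rewrite (renamed_apart_disjoint apart_h xh).
rewrite gsubstD [gsubst s R]gsubst_fix // => x xR; apply: match_s.2.
apply: contraL xR => /avars_head xh.
by rewrite (renamed_apart_disjoint apart_h xh).
Qed.

Lemma match_unif_steps G G' : match_steps Phi G G' -> unif_steps Phi G G'.
Proof.
elim=> {G G'} [G G' /match_unif_step|G|G G' G'' _ IH1 _ IH2].
- exact: rt_step.
- exact: rt_refl.
- exact: rt_trans IH1 IH2.
Qed.

Lemma unif_step_variant G G' H :
  unif_step Phi G G' -> variant G' H -> unif_step Phi G H.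
Proof.
case=> A [R [h [g [-> apart_h mgu_g ->]]]] [r [bij_r ->]].
exists A, R, h, (scomp (ren S r) g); split=> //; first exact: mgu_ren.
by rewrite gsubst_comp.
Qed.

(** The initial LP-Unif step guarantees that some last step exists to absorb the renaming. *)
Lemma unif_steps_variant G G1 G2 H :
  unif_step Phi G G1 -> match_steps Phi G1 G2 -> variant G2 H -> unif_steps Phi G H.
Proof.
move=> GG1 /clos_rt_rtn1_iff G1G2 var_H; case: G2 / G1G2 var_H => [|G2 G3 G23 G1G2] var_H.
  by apply: rt_step; apply: unif_step_variant var_H.
apply: rt_trans (rt_step _ _ _ _ GG1) _; apply: rt_trans (_ : unif_steps Phi G1 G2) _.
  exact/match_unif_steps/clos_rt_rtn1_iff.
by apply: rt_step; apply: unif_step_variant (match_unif_step G23) var_H.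
Qed.

(** After [g] the selected atom is an instance of the head. The body-only variables of [h] are
    foreign to both unified atoms, so [g] sends them to distinct isolated variables, which serve as
    the fresh names. *)
Lemma subst_match_step A R h g :
  renamed_apart Phi (A +` R) h -> mgu g (hhead h) A ->
  match_step Phi (gsubst g (A +` R)) (gsubst g (seq_mset (hbody h) `+` R)).
Proof.
move=> apart_h mgu_g; have [k [h0 [r [kh0 bij_r eq_h fresh_h]]]] := apart_h.
have inj_r := bij_inj bij_r.
have outside x : x \in body_vars h0 ->
    g (r x) = Var (var_of (g (r x)))
    /\ forall y, y != r x -> var_of (g (r x)) \notin tvars (g y).
  rewrite mem_body_vars => /andP[x'h xh0].
  apply: (mgu_outside mgu_g).
    by rewrite eq_h; apply/negP => /avars_ren[y yh /inj_r xy]; rewrite xy yh in x'h.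
  have rxh : r x \in hvars h by rewrite eq_h; apply/hvars_ren; exists x.
  by rewrite (renamed_apart_disjoint apart_h rxh).
(* With [A] replaced by the head, the step is the image under [g] of the clause matching its own
   renamed head. *)
have -> : gsubst g (A +` R) = gsubst g (hhead h +` R) by rewrite !gsubst1D mgu_g.1.
have -> : seq_mset (hbody h) = gsubst (ren S r) (seq_mset (hbody h0)).
  by rewrite eq_h gsubst_seq.
apply: (match_step_gsubst (e := r) (e' := fun x => var_of (g (r x))) kh0) => //.
- by rewrite eq_h.
- by move=> x /outside[].
- move=> x y /outside[_ out_x] /outside[gy _] eq_xy; apply: inj_r; apply/eqP.
  apply/negPn/negP; rewrite eq_sym => /out_x.
  by rewrite gy inE eq_xy eqxx.
- move=> x xh; have [_ out_x] := outside x xh.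
  have -> : gsubst g (hhead h +` R) = gsubst g (A +` R) by rewrite !gsubst1D mgu_g.1.
  apply/gvars_gsubst => -[y yG]; apply/negP; apply: out_x.
  apply: contraTneq yG => ->; apply: fresh_h; rewrite eq_h.
  by apply/hvars_ren; exists x; move: xh; rewrite // mem_body_vars => /andP[].
Qed.

Lemma struct_unif_steps G H : struct_steps Phi G H -> unif_steps Phi G H.
Proof.
case=> [<-|[N [/clos_rt_rtn1_iff GN]]]; first exact: rt_refl.
(* The claim covers every normal form [H] of the last goal, because a [struct_step] may stop right
   after a substitutional step; the induction hypothesis is used at the normal form [M'] that
   precedes it. *)
elim: GN H => {N} [|M N [M' [nfM' opt]] _ IH] H nfH.
  exact: match_unif_steps nfH.1.
have GM' := IH _ nfM'; case: opt nfH => [<- nfH|].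
  exact: rt_trans GM' (match_unif_steps nfH.1).
case=> A [R [h [g [eqM' apart_h mgu_g ->]]]] nfH.
rewrite eqM' in apart_h nfH GM'.
(* Normalization after the substitutional step may start elsewhere; confluence lets it start with
   the atom just instantiated, up to a variant. *)
have [H' steps_H' var_H'] := match_nf_step nfH (subst_match_step apart_h mgu_g).
apply: rt_trans GM' _; apply: unif_steps_variant steps_H' (variant_sym var_H').
by exists A, R, h, g.
Qed.

(** * From LP-Unif to LP-Struct *)

Definition reducible A : Prop :=
  exists k h t, (k, h) \in clauses Phi /\ asubst t (hhead h) = A.

(** The atom [asubst g A] is an instance of both the unified and the matching head, so non-overlap
    identifies the clauses. The resulting matcher and [g] are then two most general unifiers of the
    same atoms. *)
Lemma unif_match_step A R h g :
  renamed_apart Phi (A +` R) h -> mgu g (hhead h) A -> reducible A ->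
  exists2 G, match_step Phi (A +` R) G
    & variant G (gsubst g (seq_mset (hbody h) `+` R)).
Proof.
move=> apart_h mgu_g [k' [h' [t [kh' tA]]]].
have [k [h0 [r [kh0 [r' rK r'K] eq_h _]]]] := apart_h.
have eq_h' : h0 = h'.
  apply: (non_overlapping_clause (s := scomp g (ren S r)) (s' := scomp g t) kh0 kh').
  by rewrite -!asubst_comp tA -mgu_g.1 eq_h.
subst h'; pose s z := if z \in avars (hhead h) then t (r' z) else Var z.
have match_s : matcher s (hhead h) A.
  split; last by move=> x /negPf xh; rewrite /s xh.
  rewrite -tA [in LHS]eq_h asubst_comp; apply/asubst_eqP => x xh.
  have rxh : r x \in avars (hhead h) by rewrite eq_h; apply/avars_ren; exists x.
  by rewrite /scomp /= /s rxh rK.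
exists (gsubst s (seq_mset (hbody h)) `+` R); first by exists A, R, h, s.
have -> : gsubst s (seq_mset (hbody h)) `+` R = gsubst s (seq_mset (hbody h) `+` R).
  rewrite gsubstD [gsubst s R]gsubst_fix // => x xR; apply: match_s.2.
  apply: contraL xR => /avars_head xh.
  by rewrite (renamed_apart_disjoint apart_h xh).
apply: mgu_variant mgu_g; apply: matcher_mgu match_s => x /avars_head xh.
by rewrite (renamed_apart_disjoint apart_h xh).
Qed.

Hypothesis Hprod : productive Phi.

(** Productivity only denies infinite sequences; a goal that is not accessible would start one, by
    choosing successors that are again not accessible. *)
Lemma match_step_wf G : Acc (fun G2 G1 => match_step Phi G1 G2) G.
Proof.
apply: contrapT => nG; pose T := {G1 | ~ Acc (fun G2 G1 => match_step Phi G1 G2) G1}.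
have next (x : T) : {y : T | match_step Phi (sval x) (sval y)}.
  apply: cid; apply: contrapT => no_next; case: (svalP x); constructor=> y xy.
  by apply: contrapT => ny; case: no_next; exists (exist _ y ny).
pose chain := fix F n : T := if n is n'.+1 then sval (next (F n')) else exist _ G nG.
case: Hprod; exists (fun n => sval (chain n)) => n.
exact: (svalP (next (chain n))).
Qed.

Lemma match_nf_exists G : exists N, match_nf Phi G N.
Proof.
elim: {G}(match_step_wf G) => G _ IH.
have [[G1 GG1]|nfG] := pselect (exists G', match_step Phi G G'); last first.
  by exists G; split=> //; apply: rt_refl.
have [N [G1N nfN]] := IH _ GG1; exists N; split=> //.
by apply: rt_trans G1N; apply: rt_step.
Qed.

(** As no clause matches [A], normalization acts on [R] alone. Each of its steps survives [g], and
    [h] stays renamed apart, provided its fresh names avoid [h]. *)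
Lemma unif_match_nf A R h g :
  renamed_apart Phi (A +` R) h -> mgu g (hhead h) A -> ~ reducible A ->
  exists R', [/\ match_nf Phi (A +` R) (A +` R'), renamed_apart Phi (A +` R') h
    & match_steps Phi (gsubst g (seq_mset (hbody h) `+` R))
                      (gsubst g (seq_mset (hbody h) `+` R'))].
Proof.
move=> apart_h mgu_g irrA; move eqG: (A +` R) (match_step_wf (A +` R)) => G wfG.
elim: wfG R eqG apart_h => {}G _ IH R eqG apart_h; subst G.
have [[G1 GG1]|nfG] := pselect (exists G', match_step Phi (A +` R) G'); last first.
  by exists R; split=> //; [split=> // |]; apply: rt_refl.
have [k1 [h1 [A1 [R1 [t1 [e1 [kh1 eqR tA1 fr1 _]]]]]]] := match_step_elim GG1.
have [[eqA _]|[Q [eqRQ eqR1]]] := mset1D_eq eqR.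
  by case: irrA; exists k1, h1, t1; rewrite eqA.
subst R R1.
have [m fresh_m] := fresh_shift (gvars (A +` (A1 +` Q)) ++ hvars h).
have {fresh_m} fresh_m x : (x + m \notin gvars (A +` (A1 +` Q))) * (x + m \notin hvars h).
  by have := fresh_m x; rewrite mem_cat negb_or => /andP[-> ->].
have [||t [tA fr_t _ _]] := refresh_instance (e' := addn^~ m) tA1 fr1.
  - by move=> x y _ _ /addIn.
  - by move=> x _; rewrite -eqR fresh_m.
have [tE _ _] := fr_t; set G2 := gsubst t (seq_mset (hbody h1)).
have st : match_step Phi (A +` (A1 +` Q)) (A +` (G2 `+` Q)).
  by rewrite eqR (msetDCA _ G2); apply: match_step_intro kh1 tA fr_t.
have apart_h' : renamed_apart Phi (A +` (G2 `+` Q)) h.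
  have [k [h0 [r [kh0 bij_r eq_h fresh_h]]]] := apart_h.
  exists k, h0, r; split=> // x xh; apply/negP; rewrite msetDCA.
  case/(gvars_contractum tA tE) => [|[y _ xy]].
    by rewrite -eqR; apply/negP/fresh_h.
  by have := (fresh_m y).2; rewrite -xy xh.
have [R' [[nf1 nf2] apart_R' steps_R']] := IH _ st _ erefl apart_h'.
exists R'; split=> //; first by split=> //; apply: rt_trans nf1; apply: rt_step.
apply: rt_trans steps_R'; apply: rt_step.
rewrite msetDCA (msetDCA _ G2).
(* The fresh names occur neither in the head nor in [A], so [g] sends them to isolated variables. *)
have outside x : g (x + m) = Var (var_of (g (x + m)))
    /\ forall y, y != x + m -> var_of (g (x + m)) \notin tvars (g y).
  apply: (mgu_outside mgu_g).
    by apply/negP => /avars_head; rewrite (negPf (fresh_m x).2).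
  by have := (fresh_m x).1; rewrite gvars1D negb_or => /andP[].
apply: (match_step_gsubst (e' := fun x => var_of (g (x + m))) kh1 tA tE).
- by move=> x _; have [] := outside x.
- move=> x y _ _ eq_xy; have [_ out_x] := outside x; have [gy _] := outside y.
  apply: (@addIn m); apply/eqP/negPn/negP; rewrite eq_sym => /out_x.
  by rewrite gy inE eq_xy eqxx.
- move=> x _; have [_ out_x] := outside x.
  apply/gvars_gsubst => -[y yG]; apply/negP; apply: out_x.
  apply: contraTneq yG => ->; have xQ : x + m \notin gvars (A1 +` Q).
    by have := (fresh_m x).1; rewrite gvars1D negb_or => /andP[].
  rewrite msetDCA gvarsD negb_or xQ andbT.
  by apply/negP => /gvars_body; rewrite (negPf (fresh_m x).2).
Qed.

(** If a clause matches [A], normalization alone simulates the step, up to a variant. Otherwise the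
    rest is normalized, [g] is applied, and matching the instantiated atom first makes both sides
    reach exactly the same normal form. *)
Lemma unif_struct_steps G H :
  unif_step Phi G H -> exists C, struct_steps Phi G C /\
    exists C', match_steps Phi H C' /\ variant C C'.
Proof.
case=> A [R [h [g [-> apart_h mgu_g ->]]]].
have [redA|irrA] := pselect (reducible A).
  have [G1 GG1 var_G1] := unif_match_step apart_h mgu_g redA.
  have [C [G1C nfC]] := match_nf_exists G1.
  have [C' steps_C' var_C] := match_steps_variant G1C var_G1.
  exists C; split; last by exists C'.
  right; exists (A +` R); split; first exact: rt_refl.
  by split=> //; apply: rt_trans G1C; apply: rt_step.
have [R' [nf_R' apart_h' steps_R']] := unif_match_nf apart_h mgu_g irrA.
have st := subst_match_step apart_h' mgu_g.
have [C [steps_C nfC]] := match_nf_exists (gsubst g (seq_mset (hbody h) `+` R')).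
exists C; split; last first.
  by exists C; split; [exact: rt_trans steps_C | exact: variant_refl].
right; exists (gsubst g (A +` R')); split.
  apply: rt_step; exists (A +` R'); split=> //; right.
  by exists A, R', h, g.
by split=> //; apply: rt_trans steps_C; apply: rt_step.
Qed.

End Matching.

Theorem theorem10 (S : signature) (K : eqType) (Phi : program S K)
    (Hno : non_overlapping Phi) (Hprod : productive Phi) :
  (forall A B : goal S, unif_step Phi A B ->
     exists C : goal S, struct_steps Phi A C /\
       exists C' : goal S, match_steps Phi B C' /\ variant C C') /\
  (forall A B : goal S, struct_steps Phi A B -> unif_steps Phi A B).
Proof.
split=> A B; [exact: (unif_struct_steps Hno Hprod) | exact: (struct_unif_steps Hno)].
Qed.
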